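(* Let $\chi:\mathbb{R}^+\to\mathbb{R}$ be a kernel with compact support and let $f:\mathbb{R}^{+}\rightarrow \mathbb{R}$ be a bounded measurable function. If $\operatorname{supp} \chi \subset (1,\infty)$, then for every $w>0$ and $t\in\mathbb{R}^{+}$ with $w\log t \in \mathbb{Z}$, we have \[ (I_{w}^{\chi}f)(t)= \sum_{k<w\log t} \chi(e^{-k}t^{w})\,w\int_{k/w}^{(k+1)/w}f(e^{u})\,du.\] Further, if $\operatorname{supp} \chi \subset (e,\infty)$, then for every $w>0$ and $t\in\mathbb{R}^{+}$ with $w\log t \notin \mathbb{Z}$, there holds \[(I_{w}^{\chi}f)(t)=\sum_{k\leq \lfloor w\log t\rfloor -1} \chi(e^{-k}t^{w})\,w\int_{k/w}^{(k+1)/w}f(e^{u})\,du.\] (In both sums $k$ ranges over integers.)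
   Context: $\mathbb{R}^+$ denotes the positive real numbers and $\lfloor\cdot\rfloor$ the integer part (floor). A function $\chi:\mathbb{R}^+\to\mathbb{R}$ is called a kernel if: (i) $\chi\in L^1(\mathbb{R}^+)$ and $\chi$ is bounded on $[1/e,e]$; (ii) $\sum_{k=-\infty}^{+\infty}\chi(e^{-k}u)=1$ for every $u\in\mathbb{R}^+$; (iii) for some $\nu>0$, $\sup_{u\in\mathbb{R}^+}\sum_{k=-\infty}^{+\infty}|\chi(e^{-k}u)|\,|k-\log u|^{\nu}<+\infty$. For $w>0$ and bounded measurable $f:\mathbb{R}^+\to\mathbb{R}$, the Kantorovich exponential sampling series is \[(I_{w}^{\chi}f)(x)= \sum_{k= - \infty}^{+\infty} \chi(e^{-k} x^{w})\, w \int_{k/w}^{(k+1)/w} f(e^{u})\, du,\quad x\in\mathbb{R}^+.\] *)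

(* Defs.v *)
From mathcomp Require Import all_boot all_order all_algebra.
From mathcomp Require Import all_classical all_reals all_analysis.

Set Implicit Arguments.
Unset Strict Implicit.
Unset Printing Implicit Defensive.
Import Order.TTheory GRing.Theory Num.Theory.
Import numFieldNormedType.Exports.

Local Open Scope classical_set_scope.
Local Open Scope ring_scope.

(* A function on the positive reals is a total function [R -> R] of which only
   the values on `]0, +oo[ are ever used. *)

Section bilateral_series.
Context {R : realType}.
Implicit Types (D : set int) (a : int -> R).

(* The series of the a k, k in D, converges when its part with k >= 0 and its
   part with k < 0 both converge; indices outside D contribute 0. *)
Definition zcvg D a : Prop :=
  cvgn (series (fun n => (a \_ D) (Posz n))) /\
  cvgn (series (fun n => (a \_ D) (Negz n))).

(* Meaningful only under [zcvg D a]. *)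
Definition zsum D a : R :=
  limn (series (fun n => (a \_ D) (Posz n))) +
  limn (series (fun n => (a \_ D) (Negz n))).

End bilateral_series.

Section exponential_sampling.
Context {R : realType}.
Implicit Types (chi f : R -> R) (w x : R).

(* [completed_lebesgue_measure] lives on the sigma-algebra of all Lebesgue
   measurable sets, whereas [lebesgue_measure] only knows the Borel sets. *)
Definition lebesgue_measurable_fun (D : set R) f : Prop :=
  measurable_fun (D : set (caratheodory_type
    (measure_extension.mu_ext (lebesgue_stieltjes_measure.wlength idfun)))) f.

(* The closure is taken relatively to `]0, +oo[: 0 never belongs to the
   support, so a compact support is bounded away from 0. *)
Definition supp chi : set R :=
  closure [set x | 0 < x /\ chi x != 0] `&` `]0, +oo[.

Definition abs_moment chi (nu : R) : \bar R :=
  ereal_sup [set (\esum_(k in [set: int])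
      (`|chi (expR (- k%:~R) * u)| * `|k%:~R - ln u| `^ nu)%:E)%E
    | u in `]0, +oo[].

Record is_kernel chi : Prop := IsKernel {
  kernel_integrable :
    (@completed_lebesgue_measure R).-integrable `]0, +oo[ (EFin \o chi) ;
  kernel_bounded : [bounded chi x | x in `[(expR 1)^-1, expR 1]] ;
  kernel_partition : forall u : R, 0 < u ->
    zcvg [set: int] (fun k => chi (expR (- k%:~R) * u)) /\
    zsum [set: int] (fun k => chi (expR (- k%:~R) * u)) = 1 ;
  kernel_moment : exists2 nu : R, 0 < nu &
    (abs_moment chi nu < +oo)%E
}.

Definition kantorovich_term chi f w x (k : int) : R :=
  chi (expR (- k%:~R) * x `^ w) *
  (w * \int[completed_lebesgue_measure]_(u in `[k%:~R / w, (k%:~R + 1) / w])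
         f (expR u)).

Definition kantorovich chi f w x : R :=
  zsum [set: int] (kantorovich_term chi f w x).

End exponential_sampling.

(* Main.v *)
(* Writing exp(-k) t^w = exp(w ln t - k), a nonzero term of the series forces
   w ln t - k > c whenever supp chi lies in ]exp c, +oo[, while boundedness of
   supp chi bounds k from below.  Hence only finitely many terms are nonzero and
   all of them have k < w ln t - c; the two claims are the cases c = 0 and
   c = 1. *)
Require Import Defs.
From mathcomp Require Import all_boot all_order all_algebra.
From mathcomp Require Import all_classical all_reals all_analysis.
From mathcomp Require Import lra.
Import Order.TTheory GRing.Theory Num.Theory.
Import numFieldNormedType.Exports.
Local Open Scope classical_set_scope.
Local Open Scope ring_scope.

(** The partial sums are constant from index [N] on. *)
Lemma is_cvg_series_near0 {R : realType} (u : R^nat) (N : nat) :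
  (forall n, (N <= n)%N -> u n = 0) -> cvgn (series u).
Proof.
move=> u0; apply: (is_cvg_near_cst (series u N)).
exists N => // n /= Nn; apply/eqP; rewrite -subr_eq0 (sub_series_geq u Nn).
rewrite big_nat big1 // => i /andP[Ni _]; exact: u0.
Qed.

Lemma zcvg_finite_support {R : realType} (D : set int) (a : int -> R) (N : nat) :
  (forall k, a k != 0 -> (`|k| < N)%N) -> zcvg D a.
Proof.
move=> aN.
have a0 k : (N <= `|k|)%N -> (a \_ D) k = 0.
  move=> Nk; rewrite patchE; case: ifP => // _; apply/eqP.
  by apply: contraLR Nk => /aN; rewrite ltnNge.
split; apply: (@is_cvg_series_near0 _ _ N) => n Nn; apply: a0 => //.
(* [Negz n] is -(n+1), of absolute value n+1, so [N <= n] is more than enough. *)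
by rewrite NegzE abszN; exact: leqW.
Qed.

Lemma patch_support {T : Type} {R : realType} (D : set T) (a : T -> R) :
  (forall k, a k != 0 -> D k) -> a \_ D = a.
Proof.
move=> aD; apply/funext => k; rewrite patchE; case: ifPn => // /negP kD.
by case: (eqVneq (a k) 0) => [->//|/aD Dk]; case: kD; rewrite inE.
Qed.

(** Extending by 0 outside [D] leaves [a] unchanged, so both sums are limits of the same partial
    sums. Each claim thus reduces to locating the nonzero terms. *)
Lemma zcvg_zsum_support {R : realType} (D : set int) (a : int -> R) (N : nat) :
  (forall k, a k != 0 -> (`|k| < N)%N) -> (forall k, a k != 0 -> D k) ->
  [/\ zcvg [set: int] a, zcvg D a & zsum [set: int] a = zsum D a].
Proof.
move=> aN aD; split; [exact: zcvg_finite_support aN..|].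
by rewrite /zsum !patch_support.
Qed.

Lemma kantorovich_term_neq0_supp {R : realType} (chi f : R -> R) (w t : R) (k : int) :
  0 < t -> kantorovich_term chi f w t k != 0 ->
  supp chi (expR (w * ln t - k%:~R)).
Proof.
move=> t0; rewrite /kantorovich_term mulf_eq0 negb_or => /andP[+ _].
(* Since [0 < t], [powR] takes its exponential branch, and the argument of [chi] becomes a single
   exponential. *)
rewrite /powR (gt_eqF t0) -expRD addrC => chi0.
by split; [apply: subset_closure; split|rewrite /= in_itv /= andbT]; rewrite ?expR_gt0.
Qed.

Lemma kantorovich_term_localized {R : realType} (chi f : R -> R) (c w t : R) :
  compact (supp chi) -> supp chi `<=` `]expR c, +oo[ -> 0 < t ->
  (forall k, kantorovich_term chi f w t k != 0 -> k%:~R < w * ln t - c) /\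
  exists N : nat, forall k,
    kantorovich_term chi f w t k != 0 -> (`|k| < N)%N.
Proof.
(* Any real above [M] bounds the support; [|M| + 1] is such a real and is also positive, so its
   logarithm can be used below. *)
move=> /compact_bounded[M [_ /(_ (`|M| + 1))]] Mle suppc t0.
have {}Mle : forall x, supp chi x -> `|x| <= `|M| + 1.
  by apply: Mle; rewrite (le_lt_trans (ler_norm M)) // ltrDl.
have ltc k : kantorovich_term chi f w t k != 0 -> k%:~R < w * ln t - c.
  move=> /(kantorovich_term_neq0_supp _ _ _ _ _ t0)/suppc.
  by rewrite /= in_itv /= andbT ltr_expR ltrBrDl ltrBrDr.
split=> //.
set b := ln (`|M| + 1).
have geb k : kantorovich_term chi f w t k != 0 -> w * ln t - b <= k%:~R.
  move=> /(kantorovich_term_neq0_supp _ _ _ _ _ t0)/Mle.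
  rewrite ger0_norm ?expR_ge0 // -[X in _ <= X]lnK; last first.
    by rewrite posrE ltr_wpDl.
  by rewrite ler_expR lerBlDr addrC -lerBlDr.
(* The index lies between [w * ln t - b] and [w * ln t - c], so the sum of the absolute values of
   these endpoints dominates its own. *)
exists (Num.bound (`|w * ln t - c| + `|w * ln t - b|)) => k k0.
have := ltc _ k0; have := geb _ k0 => gek ltk.
rewrite -(ltr_nat R) natr_absz intr_norm.
apply: le_lt_trans (archi_boundP _); last by rewrite addr_ge0.
have h1 := ler_norm (w * ln t - c); have h2 := ler_norm (- (w * ln t - b)).
rewrite normrN in h2.
have n1 := normr_ge0 (w * ln t - c); have n2 := normr_ge0 (w * ln t - b).
rewrite ler_norml; lra.
Qed.

Theorem theorem7 (R : realType) (chi f : R -> R)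
    (chi_kernel : is_kernel chi)
    (chi_compact : compact (supp chi))
    (f_bounded : [bounded f x | x in `]0, +oo[])
    (f_measurable : lebesgue_measurable_fun `]0, +oo[ f) :
  (supp chi `<=` `]1, +oo[ ->
    forall w t : R, 0 < w -> 0 < t -> w * ln t \is a Num.int ->
    [/\ zcvg [set: int] (kantorovich_term chi f w t),
        zcvg [set k | k%:~R < w * ln t] (kantorovich_term chi f w t) &
        kantorovich chi f w t =
          zsum [set k | k%:~R < w * ln t] (kantorovich_term chi f w t)]) /\
  (supp chi `<=` `]expR 1, +oo[ ->
    forall w t : R, 0 < w -> 0 < t -> w * ln t \isn't a Num.int ->
    [/\ zcvg [set: int] (kantorovich_term chi f w t),
        zcvg [set k | k <= Num.floor (w * ln t) - 1]
          (kantorovich_term chi f w t) &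
        kantorovich chi f w t =
          zsum [set k | k <= Num.floor (w * ln t) - 1]
            (kantorovich_term chi f w t)]).
Proof.
split=> [supp1|suppe] w t w0 t0 _.
  have supp1' : supp chi `<=` `]expR 0, +oo[ by rewrite expR0.
  have [klt [N kN]] :=
    kantorovich_term_localized _ f _ w _ chi_compact supp1' t0.
  apply: zcvg_zsum_support kN _ => k /klt; by rewrite subr0.
have [klt [N kN]] :=
  kantorovich_term_localized _ f _ w _ chi_compact suppe t0.
(* The bound weakens to k + 1 <= w ln t; as k + 1 is an integer, this means k + 1 <= floor (w ln
   t). *)
apply: zcvg_zsum_support kN _ => k /klt /ltW.
by rewrite /= lerBrDr -intrD1 -floor_ge_int lerBrDr.
Qed.
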